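(* Let $f\in\mathcal{U}$, let $y\in\mathcal{Y}_F$ be a minimizer of the atomistic total energy $\Phi^{total}(y)=\Phi(y)-\langle f,y\rangle$, and let $\underline{A}:=\min_\xi A_\xi(y)$. Assume that $\underline{A}>0$ and that $\min_\xi y'_\xi\ge\frac{r^*}{2}>0$. Let $\beta$ be a blending function, $\Phi^{total}_\beta(y):=\Phi^{qnl}_\beta(y)-\langle f,y\rangle$, and $\bar C_i:=C_i(2\min_\xi y'_\xi)$ for $i=2,3,4$. There exist constants $\delta_1=\delta_1(\underline{A})>0$ and $\delta_2=\delta_2(\min_\xi y'_\xi,\underline{A},\bar C_2,\bar C_3,\beta)>0$, depending only on the indicated quantities, such that if $$2\varepsilon\bar C_3\|\Delta\beta_\xi\,y''_\xi\|_{\ell^\infty}+2\varepsilon^2\left\{\bar C_3\|(1-\beta_{\xi-1})y'''_\xi\|_{\ell^\infty}+\bar C_4\|(1-\beta_\xi)(y''_\xi)^2\|_{\ell^\infty}\right\}\le\delta_1$$ and $$\varepsilon^{\frac12}\bar C_2\|\Delta\beta_\xi\,y''_\xi\|_{\ell^2_\varepsilon}+\varepsilon^{\frac32}\left\{\bar C_2\|(1-\beta_{\xi-1})y'''_\xi\|_{\ell^2_\varepsilon}+\bar C_3\|(1-\beta_\xi)(y''_\xi)^2\|_{\ell^2_\varepsilon}\right\}\le\delta_2,$$ then there exists a locally unique minimizer $y_\beta\in\mathcal{Y}_F$ of $\Phi^{total}_\beta$ which satisfies $$\|y-y_\beta\|_{\mathcal{U}^{1,2}}\le\frac{4}{\underline{A}}\left[\varepsilon\bar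 C_2\|\Delta\beta_\xi\,y''_\xi\|_{\ell^2_\varepsilon}+\varepsilon^2\left\{\bar C_2\|(1-\beta_{\xi-1})y'''_\xi\|_{\ell^2_\varepsilon}+\bar C_3\|(1-\beta_\xi)(y''_\xi)^2\|_{\ell^2_\varepsilon}\right\}\right].$$
   Context: Let $N\in\mathbb{N}$, $\varepsilon=1/N$ and $F\in(0,\infty)$. Let $\mathcal{U}$ be the space of $u:\mathbb{Z}\to\mathbb{R}$ with $u_{\xi+N}=u_\xi$ for all $\xi$ and $\sum_{\xi=1}^N u_\xi=0$, and let $\mathcal{Y}_F$ be the set of $y:\mathbb{Z}\to\mathbb{R}$ of the form $y_\xi=F\varepsilon\xi+u_\xi$ with $u\in\mathcal{U}$. Write $\langle f,v\rangle=\varepsilon\sum_{\xi=1}^N f_\xi v_\xi$. Differences: $\Delta v_\xi=v_\xi-v_{\xi-1}$, $v'_\xi=\frac{v_\xi-v_{\xi-1}}{\varepsilon}$, $v''_\xi=\frac{v_{\xi+1}-2v_\xi+v_{\xi-1}}{\varepsilon^2}$, $v'''_\xi=\frac{v_{\xi+1}-3v_\xi+3v_{\xi-1}-v_{\xi-2}}{\varepsilon^3}$. In a product such as $\Delta\beta_\xi\,y''_\xi$, $\Delta$ acts only on $\beta$. For $N$-periodic $v$, $\|v\|_{\ell^\infty}=\max_{1\le\xi\le N}|v_\xi|$ and $\|v\|_{\ell^2_\varepsilon}=(\varepsilon\sum_{\xi=1}^N|v_\xi|^2)^{1/2}$; and $\|u\|_{\mathcal{U}^{1,2}}=\|u'\|_{\ell^2_\varepsilon}$.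 Potential (fixed): $\phi\in C^4((0,\infty],\mathbb{R})$; there is $r^*>0$ with $\phi''(r)>0$ for $r\in(0,r^* )$ and $\phi''(r)<0$ for $r\in(r^*,\infty)$; $\phi$ and its derivatives decay at infinity. $C_i(r_0):=\sup_{r\ge r_0}|\phi^{(i)}(r)|$ for $i=1,\dots,4$. Energies (for $y\in\mathcal{Y}_F$ with $y'_\xi>0$ for all $\xi$). Atomistic energy: $$\Phi(y)=\varepsilon\sum_{\xi=1}^N\{\phi(y'_\xi)+\phi(y'_\xi+y'_{\xi+1})\}.$$ BQNL energy with $N$-periodic blending function $\beta:\mathbb{Z}\to[0,1]$: $$\Phi^{qnl}_\beta(y)=\varepsilon\sum_{\xi=1}^N\Big\{\phi(y'_\xi)+\beta_\xi\phi(y'_\xi+y'_{\xi+1})+\tfrac{1-\beta_\xi}{2}\{\phi(2y'_\xi)+\phi(2y'_{\xi+1})\}\Big\}.$$ $A_\xi(y):=\phi''(y'_\xi)+2\phi''(y'_\xi+y'_{\xi+1})+2\phi''(y'_{\xi-1}+y'_\xi)$. A ''locally unique minimizer'' is a local minimizer (on $\mathcal{Y}_F$) that is the only local minimizer in some neighbourhood of itself. *)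

(* Defs.v *)
From mathcomp Require Import all_boot all_order all_algebra.
From mathcomp Require Import all_classical all_reals all_analysis.

Set Implicit Arguments.
Unset Strict Implicit.
Unset Printing Implicit Defensive.

Import Order.TTheory GRing.Theory Num.Theory.
Import numFieldNormedType.Exports.

Local Open Scope classical_set_scope.
Local Open Scope ring_scope.

(* Lattice functions are maps [int -> R]; the period [N] is a parameter of the
   operations, all of which are only meaningful for [0 < N]. *)

Definition eps (R : realType) (N : nat) : R := N%:R^-1.

Definition periodic (R : realType) (N : nat) (v : int -> R) : Prop :=
  forall xi : int, v (xi + N%:Z) = v xi.

Definition Uspace (R : realType) (N : nat) : set (int -> R) :=
  [set u | periodic N u /\ \sum_(1 <= i < N.+1) u i%:Z = 0].

Definition Yspace (R : realType) (N : nat) (F : R) : set (int -> R) :=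
  [set y | exists2 u, Uspace N u &
           forall xi : int, y xi = F * eps R N * xi%:~R + u xi].

Definition pairing (R : realType) (N : nat) (f v : int -> R) : R :=
  eps R N * \sum_(1 <= i < N.+1) f i%:Z * v i%:Z.

Definition Delta (R : realType) (v : int -> R) (xi : int) : R :=
  v xi - v (xi - 1).

Definition d1 (R : realType) (N : nat) (v : int -> R) (xi : int) : R :=
  (v xi - v (xi - 1)) / eps R N.

Definition d2 (R : realType) (N : nat) (v : int -> R) (xi : int) : R :=
  (v (xi + 1) - 2 * v xi + v (xi - 1)) / eps R N ^+ 2.

Definition d3 (R : realType) (N : nat) (v : int -> R) (xi : int) : R :=
  (v (xi + 1) - 3 * v xi + 3 * v (xi - 1) - v (xi - 2)) / eps R N ^+ 3.

Definition norm_linf (R : realType) (N : nat) (v : int -> R) : R :=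
  \big[Num.max/0]_(1 <= i < N.+1) `|v i%:Z|.

Definition norm_l2 (R : realType) (N : nat) (v : int -> R) : R :=
  Num.sqrt (eps R N * \sum_(1 <= i < N.+1) `|v i%:Z| ^+ 2).

Definition norm_U12 (R : realType) (N : nat) (u : int -> R) : R :=
  norm_l2 N (d1 N u).

(* Minimum over one period of an [N]-periodic function. The default value
   [v 1] belongs to the range, so that this is the exact minimum. *)
Definition min_period (R : realType) (N : nat) (v : int -> R) : R :=
  \big[Num.min/v 1]_(1 <= i < N.+1) v i%:Z.

(* Only the values of [phi] on (0, +oo) matter: derivatives are local, and the
   regularity and limits below are required on (0, +oo) and at +oo only. Being
   C^4 up to +oo is implied by the decay of [phi] and of its derivatives. *)
Record potential (R : realType) (phi : R -> R) (rs : R) : Prop := Potential {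
  potential_derivable : forall (k : nat) (r : R),
    (k < 4)%N -> 0 < r -> derivable (derive1n k phi) r 1 ;
  potential_continuous : forall r : R,
    0 < r -> {for r, continuous (derive1n 4 phi)} ;
  potential_decay : forall k : nat,
    (k <= 4)%N -> derive1n k phi r @[r --> +oo] --> (0 : R) ;
  potential_rs_gt0 : 0 < rs ;
  potential_convex : forall r : R, 0 < r -> r < rs -> 0 < derive1n 2 phi r ;
  potential_concave : forall r : R, rs < r -> derive1n 2 phi r < 0
}.

(* For a [potential] and [0 < r0] the set is bounded, hence [sup] is the
   genuine supremum. *)
Definition Csup (R : realType) (phi : R -> R) (i : nat) (r0 : R) : R :=
  sup [set `|derive1n i phi r| | r in [set r | r0 <= r]].

Definition blending (R : realType) (N : nat) (beta : int -> R) : Prop :=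
  periodic N beta /\ forall xi : int, 0 <= beta xi <= 1.

Definition Phi_a (R : realType) (phi : R -> R) (N : nat) (y : int -> R) : R :=
  eps R N * \sum_(1 <= i < N.+1)
    (phi (d1 N y i%:Z) + phi (d1 N y i%:Z + d1 N y (i%:Z + 1))).

Definition Phi_qnl (R : realType) (phi : R -> R) (N : nat) (beta : int -> R)
    (y : int -> R) : R :=
  eps R N * \sum_(1 <= i < N.+1)
    (phi (d1 N y i%:Z)
     + beta i%:Z * phi (d1 N y i%:Z + d1 N y (i%:Z + 1))
     + (1 - beta i%:Z) / 2
         * (phi (2 * d1 N y i%:Z) + phi (2 * d1 N y (i%:Z + 1)))).

Definition Phi_a_total (R : realType) (phi : R -> R) (N : nat) (f : int -> R)
    (y : int -> R) : R :=
  Phi_a phi N y - pairing N f y.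

Definition Phi_qnl_total (R : realType) (phi : R -> R) (N : nat)
    (beta f : int -> R) (y : int -> R) : R :=
  Phi_qnl phi N beta y - pairing N f y.

Definition A_coef (R : realType) (phi : R -> R) (N : nat) (y : int -> R)
    (xi : int) : R :=
  derive1n 2 phi (d1 N y xi)
  + 2 * derive1n 2 phi (d1 N y xi + d1 N y (xi + 1))
  + 2 * derive1n 2 phi (d1 N y (xi - 1) + d1 N y xi).

(* The domain of the energies. *)
Definition admissible (R : realType) (N : nat) (F : R) : set (int -> R) :=
  [set y | Yspace N F y /\ forall xi : int, 0 < d1 N y xi].

(* [Yspace N F] is a finite-dimensional affine space over [Uspace N], on which
   [norm_U12 N] is a norm; neighbourhoods are taken in this norm. *)
Definition local_minimizer (R : realType) (N : nat) (F : R)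
    (E : (int -> R) -> R) (y : int -> R) : Prop :=
  admissible N F y /\
  exists2 rho : R, 0 < rho &
    forall z : int -> R, admissible N F z ->
      norm_U12 N (z \- y) < rho -> E y <= E z.

Definition locally_unique_minimizer (R : realType) (N : nat) (F : R)
    (E : (int -> R) -> R) (y : int -> R) : Prop :=
  local_minimizer N F E y /\
  exists2 rho : R, 0 < rho &
    forall z : int -> R, local_minimizer N F E z ->
      norm_U12 N (z \- y) < rho -> z = y.

(* Main.v *)
Require Import Defs.
From mathcomp Require Import all_boot all_order all_algebra.
From mathcomp Require Import all_classical all_reals all_analysis.
From mathcomp Require Import ring lra.
Import Order.TTheory GRing.Theory Num.Theory.
Import numFieldNormedType.Exports.
Local Open Scope ring_scope.

Set Implicit Arguments.
Unset Strict Implicit.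
Unset Printing Implicit Defensive.

(** The theorem is a case of consistency plus stability, and both are read off
    from one quantity.  With weight [1 - beta], the blended energy replaces
    [phi (y'_i + y'_(i+1))] by the mean of [phi (2 y'_i)] and
    [phi (2 y'_(i+1))].  For [psi] a derivative of [phi], [interp_defect psi]
    collects the resulting errors of the two bonds at a site.  Expanding it about [2 y'], the first-order contributions of the two
    neighbouring bonds nearly cancel: what remains is
    [- e (Delta beta) y'' + e^2 (1 - beta) y'''] times [psi'], plus a
    quadratic remainder in [e y''] ([interp_defect_le]).

    With [psi = phi'] the defect is the coefficient of [u'] in the difference of
    the first variations of the two energies.  Since [y] is critical for the
    atomistic energy, Cauchy-Schwarz bounds the residual of [y] in the blended
    problem by [eta |u'|], where [eta] is the bracket of the error estimate
    ([dPhi_qnl_consistency]).  With [psi = phi''] twice the defect is the loss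
    in the coefficient [A]; the first smallness condition keeps this loss
    below [A / 4] ([A_qnl_ge]).  Next-nearest bonds have length at least
    [2 min y' >= rs], where [phi] is concave, so [(a + b)^2 <= 2 (a^2 + b^2)]
    makes the second variation at [y] diagonally bounded below by these
    coefficients.

    Strains within [rho] of [y'] perturb each coefficient by at most a fixed
    multiple of [rho], so the blended energy is uniformly convex, with modulus
    [A / 2], on a whole ball about [y] ([Phi_qnl_ge_quadratic]).  The ball is
    taken of radius [rho sqrt e] in the energy norm, which controls the strains
    in the maximum norm.  This replaces the inverse function theorem: the ball
    is compact, so the energy has a minimizer [yb] on it; comparing the
    energies of [y] and [yb] gives [|y - yb| <= 2 eta / (A / 2)], which by the
    second smallness condition is less than the radius.  So [yb] is interior,
    hence a local minimizer, and convexity excludes any other local minimizer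
    nearby ([qnl_minimizer_near]). *)

(** * The potential: bounds on derivatives and quadratic expansions *)

(** Rolle's theorem applied to the remainder at [b] of the first-order expansion
    about a moving point [t], corrected by [K / 2 * (b - t) ^+ 2] with [K] such
    that the result also vanishes at [t = a]. The minimum and maximum let [b]
    lie on either side of [a]. *)
Lemma taylor2_lagrange (R : realType) (f f1 f2 : R -> R) (a b : R) :
  (forall r : R, 0 < r -> is_derive r 1 f (f1 r)) ->
  (forall r : R, 0 < r -> is_derive r 1 f1 (f2 r)) ->
  0 < a -> 0 < b ->
  exists2 s, Num.min a b <= s <= Num.max a b &
    f b = f a + f1 a * (b - a) + f2 s / 2 * (b - a) ^+ 2.
Proof.
move=> df df1 a0 b0; have [->|neq] := eqVneq a b.
  exists b; first by rewrite minxx maxxx lexx.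
  by ring.
have ba0 : b - a != 0 by rewrite subr_eq0 eq_sym.
pose K := 2 * (f b - f a - f1 a * (b - a)) / (b - a) ^+ 2.
pose h t := f b - f t - f1 t * (b - t) - K / 2 * (b - t) ^+ 2.
have dh (r : R) : 0 < r -> is_derive r 1 h ((K - f2 r) * (b - r)).
  move=> r0; have Df := df _ r0; have Df1 := df1 _ r0.
  rewrite /h; apply: is_derive_eq.
  by rewrite /GRing.scale /=; field.
have hb : h b = 0 by rewrite /h; ring.
have ha : h a = 0 by rewrite /h /K; field.
have rolle (c d : R) : 0 < c -> c < d -> h c = h d ->
    exists2 s, c < s < d & (K - f2 s) * (b - s) = 0.
  move=> c0 cd hcd.
  have pos t : c <= t -> 0 < t by exact: lt_le_trans.
  have [||//|s] := @Rolle R h c d cd.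
  - move=> r; rewrite in_itv/= => /andP[/ltW /pos /dh Dr _].
    exact: ex_derive.
  - apply: derivable_within_continuous => r.
    by rewrite in_itv/= => /andP[/pos /dh Dr _]; exact: ex_derive.
  rewrite in_itv/= => scd Ds; exists s => //.
  have /pos/dh Ds' : c <= s by case/andP: scd => /ltW.
  by rewrite -(@derive_val _ _ _ _ _ _ _ Ds') (@derive_val _ _ _ _ _ _ _ Ds).
have [s s_between] : exists2 s, Num.min a b < s < Num.max a b &
    (K - f2 s) * (b - s) = 0.
  have hE : h a = h b by rewrite ha hb.
  move: neq; rewrite neq_lt minElt maxElt => /orP[]ab.
    by rewrite ab; exact: rolle.
  by rewrite ltNge (ltW ab)/=; exact: rolle.
move=> /eqP; rewrite mulf_eq0 => /orP[|]; last first.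
  rewrite subr_eq0 => /eqP bs; move: s_between.
  rewrite -bs gt_min lt_max ltxx !orbF => /andP[ba /(lt_trans ba)].
  by rewrite ltxx.
rewrite subr_eq0 => /eqP Ks; exists s.
  by case/andP: s_between => /ltW -> /ltW ->.
by rewrite -Ks /K; field.
Qed.

Section Potential.
Variables (R : realType) (phi : R -> R) (rs : R).
Hypothesis hphi : potential phi rs.

Lemma potential_is_derive (k : nat) (r : R) : (k < 4)%N -> 0 < r ->
  is_derive r 1 (derive1n k phi) (derive1n k.+1 phi r).
Proof.
move=> k4 r0; rewrite derive1nS derive1E.
exact/derivableP/(potential_derivable hphi).
Qed.

Lemma potential_continuous_at (k : nat) (r : R) : (k <= 4)%N -> 0 < r ->
  {for r, continuous (derive1n k phi)}.
Proof.
rewrite leq_eqVlt => /orP[/eqP->|k4] r0; first exact: potential_continuous hphi _ r0.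
exact/differentiable_continuous/derivable1_diffP/(potential_derivable hphi).
Qed.

(** Decay bounds the tail and compactness the rest; without this bound [Csup]
    would be the default value of [sup]. *)
Lemma potential_bounded (k : nat) (r0 : R) : (k <= 4)%N -> 0 < r0 ->
  exists M, forall r, r0 <= r -> `|derive1n k phi r| <= M.
Proof.
move=> k4 r00; have /cvgrPdist_lt/(_ _ ltr01)[A [_ hA]] := potential_decay hphi k4.
have cont : {within `[r0, Num.max r0 (A + 1)],
    continuous (fun r => `|derive1n k phi r|)}%classic.
  apply: continuous_in_subspaceT => r; rewrite inE/= in_itv/= => /andP[rr _].
  apply: continuous_comp; last exact: norm_continuous.
  exact/potential_continuous_at/(lt_le_trans r00).
have [|c _ hc] := EVT_max _ cont; first by rewrite le_max lexx.
exists (Num.max `|derive1n k phi c| 1) => r r0r; rewrite le_max.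
have [rle|rgt] := leP r (Num.max r0 (A + 1)).
  by rewrite hc// in_itv/= r0r.
apply/orP; right; have := hA r; rewrite /= sub0r normrN => /(_ _)/ltW; apply.
by apply: lt_trans rgt; rewrite lt_max ltrDl ltr01 orbT.
Qed.

Lemma le_Csup (k : nat) (r0 r : R) : (k <= 4)%N -> 0 < r0 -> r0 <= r ->
  `|derive1n k phi r| <= Csup phi k r0.
Proof.
move=> k4 r00 r0r; apply: ub_le_sup; last by exists r.
have [M hM] := potential_bounded k4 r00.
by exists M => _ [s /= r0s <-]; exact: hM.
Qed.

(** At [rs] itself the sign follows from continuity. *)
Lemma potential_derive2_le0 (r : R) : rs <= r -> derive1n 2 phi r <= 0.
Proof.
rewrite le_eqVlt => /orP[/eqP<-|/(potential_concave hphi)/ltW//].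
have rs0 := potential_rs_gt0 hphi.
have c2 := @potential_continuous_at 2 rs isT rs0.
apply: (@cvgr_to_le _ _ (at_right_proper_filter rs) _ _ _ _
  (cvg_at_right_filter c2)).
by near=> s; apply/ltW/(potential_concave hphi).
Unshelve. all: by end_near. Qed.

Lemma taylor1_Csup (k : nat) (r0 x z : R) : (k < 3)%N -> 0 < r0 ->
  r0 <= x -> r0 <= z ->
  `|derive1n k phi z - derive1n k phi x - derive1n k.+1 phi x * (z - x)|
    <= Csup phi k.+2 r0 / 2 * (z - x) ^+ 2.
Proof.
move=> k3 r00 rx rz.
have [||||s /andP[] ] := @taylor2_lagrange R (derive1n k phi)
  (derive1n k.+1 phi) (derive1n k.+2 phi) x z.
- by move=> r ?; apply: potential_is_derive => //; exact: ltnW.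
- by move=> r ?; apply: potential_is_derive.
- exact: lt_le_trans rx.
- exact: lt_le_trans rz.
rewrite ge_min => smin _ ->.
have rs' : r0 <= s by case/orP: smin; exact: le_trans.
have := @le_Csup k.+2 r0 s k3 r00 rs'.
have alg (p q t w : R) : p + q + t / 2 * w - p - q = t * (w / 2) by ring.
rewrite alg.
rewrite normrM (ger0_norm (divr_ge0 (sqr_ge0 _) _)) // => h.
by rewrite -[leRHS]mulrA (mulrC 2^-1) ler_wpM2r// divr_ge0 ?sqr_ge0.
Qed.

Lemma derive2_lipschitz (r0 x z : R) : 0 < r0 -> r0 <= x -> r0 <= z ->
  `|derive1n 2 phi z - derive1n 2 phi x| <= Csup phi 3 r0 * `|z - x|.
Proof.
move=> r00; wlog xz : x z / x <= z => [wl rx rz|rx rz].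
  have [/wl->//|/ltW /wl h] := leP x z.
  by rewrite distrC (distrC z); exact: h.
have pos t : x <= t -> 0 < t by move=> /(le_trans rx); exact: lt_le_trans.
have [||s sxz ->] := @MVT_segment R (derive1n 2 phi) (derive1n 3 phi) x z xz.
- move=> r; rewrite in_itv/= => /andP[/ltW/pos r0' _].
  exact: (@potential_is_derive 2).
- apply: derivable_within_continuous => r; rewrite in_itv/= => /andP[/pos r0' _].
  exact: (potential_derivable hphi (k := 2)).
rewrite normrM ler_wpM2r//; apply: le_Csup => //.
by move: sxz; rewrite in_itv/= => /andP[xs _]; exact: le_trans xs.
Qed.

(** The curvature is frozen at a reference length [c] and not at [x]: as [x]
    and [z] vary within [rho] of [c] the coefficient stays the same, which turns
    positivity of the second variation at one configuration into convexity
    on a neighbourhood. *)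
Lemma phi_ge_quadratic (r0 rho c x z : R) : 0 < r0 ->
  r0 <= c -> r0 <= x -> r0 <= z -> `|x - c| <= rho -> `|z - c| <= rho ->
  phi x + derive1n 1 phi x * (z - x)
    + (derive1n 2 phi c - Csup phi 3 r0 * rho) / 2 * (z - x) ^+ 2 <= phi z.
Proof.
move=> r00 rc rx rz xc zc.
have [||||s /andP[] ] := @taylor2_lagrange R phi
  (derive1n 1 phi) (derive1n 2 phi) x z.
- by move=> r ?; apply: (@potential_is_derive 0).
- by move=> r ?; apply: potential_is_derive.
- exact: lt_le_trans rx.
- exact: lt_le_trans rz.
rewrite ge_min le_max => smin smax ->.
have rs' : r0 <= s by case/orP: smin; exact: le_trans.
rewrite lerD2l ler_wpM2r ?sqr_ge0// ler_wpM2r ?invr_ge0//.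
have C0 : 0 <= Csup phi 3 r0 by apply: le_trans (@le_Csup 3 _ _ isT r00 rc).
have sc : `|s - c| <= rho.
  move: xc zc; rewrite !ler_norml => /andP[? ?] /andP[? ?].
  by apply/andP; split; case/orP: smin => ?; case/orP: smax => ?; lra.
have := derive2_lipschitz r00 rc rs'.
have := ler_wpM2l C0 sc.
rewrite ler_norml => h1 /andP[h2 _]; lra.
Qed.

End Potential.

(** * Periodic lattice functions: sums, norms and differences *)

Section Sums.
Variables (R : realType).

(** With [A], [B] the sums of squares and [S] the sum of products, the sum of
    the [(B a_i - S b_i)^2] equals [B (A B - S^2)]. *)
Lemma sum_cauchy_schwarz (r : seq nat) (a b : nat -> R) :
  \sum_(i <- r) a i * b i
    <= Num.sqrt (\sum_(i <- r) a i ^+ 2) * Num.sqrt (\sum_(i <- r) b i ^+ 2).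
Proof.
set A := \sum_(i <- r) a i ^+ 2; set B := \sum_(i <- r) b i ^+ 2.
set S := \sum_(i <- r) a i * b i.
have A0 : 0 <= A by apply: sumr_ge0 => i _; exact: sqr_ge0.
have B0 : 0 <= B by apply: sumr_ge0 => i _; exact: sqr_ge0.
rewrite -sqrtrM//; apply: le_trans (ler_norm _) _.
rewrite -sqrtr_sqr ler_sqrt ?mulr_ge0//.
have : 0 <= \sum_(i <- r) (B * a i - S * b i) ^+ 2.
  by apply: sumr_ge0 => i _; exact: sqr_ge0.
have -> : \sum_(i <- r) (B * a i - S * b i) ^+ 2 = B * (A * B - S ^+ 2).
  transitivity (\sum_(i <- r) (B ^+ 2 * a i ^+ 2 - 2 * B * S * (a i * b i)
                               + S ^+ 2 * b i ^+ 2)).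
    by apply: eq_bigr => i _; ring.
  by rewrite big_split sumrB/= -!mulr_sumr -/A -/B -/S; ring.
have [B_eq0 _|B_neq0] := eqVneq B 0; last first.
  by rewrite pmulr_rge0 ?subr_ge0// lt0r B_neq0.
have b_eq0 i : i \in r -> b i = 0.
  move=> ir; have /eqP := B_eq0.
  rewrite psumr_eq0 => [/allP/(_ _ ir)|j _]; last exact: sqr_ge0.
  by rewrite /= sqrf_eq0 => /eqP.
rewrite B_eq0 mulr0 [S](_ : _ = 0) ?expr0n//.
by apply: big1_seq => i /andP[_ ir]; rewrite b_eq0// mulr0.
Qed.

Variable N : nat.
Hypothesis N0 : (0 < N)%N.
Local Notation e := (eps R N).

Lemma eps_gt0 : 0 < e.
Proof. by rewrite invr_gt0 ltr0n. Qed.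

Lemma eps_neq0 : e != 0.
Proof. by rewrite lt0r_neq0// eps_gt0. Qed.

Lemma periodic_mulz (v : int -> R) (xi q : int) :
  Defs.periodic N v -> v (xi + q * N%:Z) = v xi.
Proof.
move=> pv; have posq (n : nat) x : v (x + n%:Z * N%:Z) = v x.
  elim: n => [|n IHn]; first by rewrite mul0r addr0.
  by rewrite intS mulrDl mul1r addrCA addrC pv IHn.
case: q => n; first exact: posq.
by rewrite NegzE mulNr -[in RHS](subrK (n.+1%:Z * N%:Z) xi) posq.
Qed.

Lemma int_period_repr (xi : int) :
  exists (i : nat) (q : int), (1 <= i < N.+1)%N /\ xi = i%:Z + q * N%:Z.
Proof.
have N0' : N%:Z != 0 by rewrite eqz_nat -lt0n.
have h0 := modz_ge0 (xi - 1) N0'.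
have h1 := @ltz_pmod (xi - 1) N%:Z N0.
have h2 := divz_eq (xi - 1) N%:Z.
exists (`|((xi - 1) %% N%:Z)%Z|%N.+1), ((xi - 1) %/ N%:Z)%Z; split.
  by rewrite /= ltnS -ltz_nat gez0_abs.
by rewrite intS gez0_abs// -addrA [X in 1 + X]addrC -h2 addrC subrK.
Qed.

Lemma periodicP (P : R -> Prop) (v : int -> R) : Defs.periodic N v ->
  (forall i : nat, (1 <= i < N.+1)%N -> P (v i%:Z)) -> forall xi, P (v xi).
Proof.
move=> pv Pv xi; have [i [q [iN ->]]] := int_period_repr xi.
by rewrite periodic_mulz//; exact: Pv.
Qed.

Lemma sum_shift (v : int -> R) : Defs.periodic N v ->
  \sum_(1 <= i < N.+1) v (i%:Z + 1) = \sum_(1 <= i < N.+1) v i%:Z.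
Proof.
move=> pv; rewrite big_nat_recr//= [RHS]big_ltn// [in RHS]big_add1/= addrC.
congr (_ + _); first by rewrite addrC pv.
by apply: eq_bigr => i _; rewrite intS addrC.
Qed.

Lemma periodic_shift (v : int -> R) (k : int) :
  Defs.periodic N v -> Defs.periodic N (fun xi => v (xi + k)).
Proof. by move=> pv xi; rewrite addrAC pv. Qed.

Lemma sum_shiftN (v : int -> R) : Defs.periodic N v ->
  \sum_(1 <= i < N.+1) v (i%:Z - 1) = \sum_(1 <= i < N.+1) v i%:Z.
Proof.
move=> pv; rewrite -(sum_shift (periodic_shift (-1) pv)).
by apply: eq_bigr => i _; rewrite addrK.
Qed.

Lemma min_period_le (v : int -> R) (xi : int) : Defs.periodic N v ->
  min_period N v <= v xi.
Proof.
move=> pv; apply: (@periodicP (fun x => min_period N v <= x) v pv) => i iN.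
by apply: bigmin_inf_seq (lexx _); rewrite // mem_index_iota.
Qed.

Lemma le_norm_linf (v : int -> R) (xi : int) : Defs.periodic N v ->
  `|v xi| <= norm_linf N v.
Proof.
move=> pv; apply: (@periodicP (fun x => `|x| <= norm_linf N v) v pv) => i iN.
apply: (@le_bigmax_seq _ _ _ _ 0 i predT (fun i : nat => `|v i%:Z|)) => //.
by rewrite mem_index_iota.
Qed.

Lemma sum_sqr_ge0 (v : int -> R) : 0 <= e * \sum_(1 <= i < N.+1) v i%:Z ^+ 2.
Proof.
rewrite mulr_ge0 ?(ltW eps_gt0)//.
by apply: sumr_ge0 => i _; exact: sqr_ge0.
Qed.

Lemma norm_l2E (v : int -> R) :
  norm_l2 N v = Num.sqrt (e * \sum_(1 <= i < N.+1) v i%:Z ^+ 2).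
Proof.
congr (Num.sqrt (_ * _)); apply: eq_bigr => i _.
by rewrite real_normK ?num_real.
Qed.

Lemma norm_l2_ge0 (v : int -> R) : 0 <= norm_l2 N v.
Proof. exact: sqrtr_ge0. Qed.

Lemma sqr_norm_l2 (v : int -> R) :
  norm_l2 N v ^+ 2 = e * \sum_(1 <= i < N.+1) v i%:Z ^+ 2.
Proof. by rewrite norm_l2E sqr_sqrtr// sum_sqr_ge0. Qed.

(** The inverse inequality: control of strains in the energy norm costs a factor
    [e ^ (-1/2)] in the maximum norm. *)
Lemma le_norm_l2 (v : int -> R) (xi : int) : Defs.periodic N v ->
  Num.sqrt e * `|v xi| <= norm_l2 N v.
Proof.
move=> pv; apply: (@periodicP (fun x => Num.sqrt e * `|x| <= norm_l2 N v) v pv).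
move=> i iN; rewrite norm_l2E -sqrtr_sqr -sqrtrM ?(ltW eps_gt0)//.
rewrite ler_sqrt ?sum_sqr_ge0// ler_wpM2l ?(ltW eps_gt0)//.
rewrite (bigD1_seq i) ?mem_index_iota ?iota_uniq//= lerDl.
by apply: sumr_ge0 => j _; exact: sqr_ge0.
Qed.

Lemma pairing_le (a b : int -> R) :
  e * \sum_(1 <= i < N.+1) `|a i%:Z| * `|b i%:Z| <= norm_l2 N a * norm_l2 N b.
Proof.
have e0 := ltW eps_gt0.
rewrite /norm_l2 !sqrtrM// mulrACA -expr2 sqr_sqrtr// ler_wpM2l//.
exact: (@sum_cauchy_schwarz _ (fun i => `|a i%:Z|) (fun i => `|b i%:Z|)).
Qed.

Lemma norm_l2_shiftN (v : int -> R) : Defs.periodic N v ->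
  norm_l2 N (fun xi => v (xi - 1)) = norm_l2 N v.
Proof.
move=> pv; rewrite !norm_l2E; congr (Num.sqrt (_ * _)).
by rewrite (@sum_shiftN (fun xi => v xi ^+ 2))// => xi; rewrite pv.
Qed.

Lemma norm_l2Z (c : R) (v : int -> R) :
  norm_l2 N (fun xi => c * v xi) = `|c| * norm_l2 N v.
Proof.
rewrite !norm_l2E -sqrtr_sqr -sqrtrM ?sqr_ge0//; congr Num.sqrt.
rewrite mulrCA; congr (_ * _); rewrite mulr_sumr.
by apply: eq_bigr => i _; rewrite exprMn.
Qed.

Lemma d1_periodic (u : int -> R) : Defs.periodic N u -> Defs.periodic N (d1 N u).
Proof. by move=> pu xi; rewrite /d1 pu addrAC pu. Qed.

Lemma Uspace_lin (a b : R) (u v : int -> R) :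
  Uspace N u -> Uspace N v -> Uspace N (fun x => a * u x + b * v x).
Proof.
move=> [pu su] [pv sv]; split; first by move=> xi; rewrite pu pv.
by rewrite big_split/= -!mulr_sumr su sv !mulr0 addr0.
Qed.

Lemma Yspace_d1_periodic (F : R) (y : int -> R) :
  Yspace N F y -> Defs.periodic N (d1 N y).
Proof.
move=> [u [pu _] yE] xi; rewrite /d1 !yE [xi + N%:Z - 1]addrAC !pu.
by congr (_ / _); rewrite !intrD; ring.
Qed.

Lemma Yspace_sub (F : R) (y z : int -> R) :
  Yspace N F y -> Yspace N F z -> Uspace N (y \- z).
Proof.
move=> [u Uu yE] [v Uv zE].
rewrite (_ : y \- z = fun x => 1 * u x + (-1) * v x); first exact: Uspace_lin.
by apply/funext => xi /=; rewrite yE zE; ring.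
Qed.

Lemma Yspace_add (F t : R) (y u : int -> R) :
  Yspace N F y -> Uspace N u -> Yspace N F (fun xi => y xi + t * u xi).
Proof.
move=> [v Uv yE] Uu; exists (fun x => 1 * v x + t * u x).
  exact: Uspace_lin.
by move=> xi; rewrite yE; ring.
Qed.

Lemma d1_add (t : R) (y u : int -> R) (xi : int) :
  d1 N (fun x => y x + t * u x) xi = d1 N y xi + t * d1 N u xi.
Proof. by rewrite /d1; ring. Qed.

Lemma d1_sub (y z : int -> R) (xi : int) :
  d1 N (y \- z) xi = d1 N y xi - d1 N z xi.
Proof. by rewrite /d1 /=; ring. Qed.

Lemma telescope_le (u : int -> R) (D : R) :
  (forall xi, `|u xi - u (xi - 1)| <= D) ->
  forall (x : int) (n : nat), `|u (x + n%:Z) - u x| <= D *+ n.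
Proof.
move=> uD x; elim=> [|n IHn]; first by rewrite addr0 subrr normr0.
rewrite mulrS; apply: le_trans (lerD (uD (x + n.+1%:Z)) IHn).
rewrite (_ : x + n.+1%:Z - 1 = x + n%:Z); last by rewrite intS; ring.
by apply: le_trans (ler_normD _ _); rewrite addrA subrK.
Qed.

(** A mean-zero [u] satisfies [N u_j = sum_i (u_j - u_i)], and each difference
    telescopes over fewer than [N] steps. *)
Lemma Uspace_bound (u : int -> R) (D : R) : Uspace N u ->
  (forall xi, `|u xi - u (xi - 1)| <= D) -> forall xi, `|u xi| <= D *+ N.
Proof.
move=> [pu su] uD.
have D0 : 0 <= D by exact: le_trans (uD 0).
apply: (@periodicP (fun x => `|x| <= D *+ N) u pu) => j /andP[j1 jN].
have dist i : (1 <= i < N.+1)%N -> `|u j%:Z - u i%:Z| <= D *+ N.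
  move=> /andP[i1 iN]; wlog ij : i j i1 iN j1 jN / (i <= j)%N => [wl|].
    have [/wl|/ltnW/wl] := leqP i j; first exact.
    by rewrite distrC; exact.
  have := telescope_le uD i%:Z (j - i)%N.
  rewrite -PoszD subnKC// => /le_trans; apply; apply: ler_wpMn2l => //.
  by apply: leq_trans (leq_subr _ _) _; rewrite -ltnS.
have NE : \sum_(1 <= i < N.+1) (u j%:Z - u i%:Z) = u j%:Z *+ N.
  by rewrite sumrB su subr0 sumr_const_nat subn1.
rewrite -(ler_pMn2r N0) -normrMn -NE.
apply: le_trans (ler_norm_sum _ _ _) _.
have -> : D *+ N *+ N = \sum_(1 <= i < N.+1) D *+ N.
  by rewrite sumr_const_nat subn1.
rewrite !big_seq; apply: ler_sum => i; rewrite mem_index_iota; exact: dist.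
Qed.

Lemma Uspace_norm_eq0 (u : int -> R) : Uspace N u -> norm_U12 N u = 0 ->
  forall xi, u xi = 0.
Proof.
move=> Uu u0 xi; have pu : Defs.periodic N u by case: Uu.
apply/eqP; rewrite -normr_le0 -(mul0rn _ N); apply: Uspace_bound Uu _ xi => x.
have := le_norm_l2 x (d1_periodic pu); rewrite -/(norm_U12 N u) u0.
rewrite pmulr_rle0 ?sqrtr_gt0 ?eps_gt0// normr_le0 mulf_eq0 invr_eq0.
by rewrite (negbTE eps_neq0) orbF => /eqP->; rewrite normr0.
Qed.

End Sums.

Lemma d2E (R : realType) (N : nat) (y : int -> R) (xi : int) : (0 < N)%N ->
  d2 N y xi = (d1 N y (xi + 1) - d1 N y xi) / eps R N.
Proof.
move=> N0; have en0 := eps_neq0 R N0.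
by rewrite /d1 /d2 addrK; field.
Qed.

Lemma d3E (R : realType) (N : nat) (y : int -> R) (xi : int) : (0 < N)%N ->
  d3 N y xi = (d2 N y xi - d2 N y (xi - 1)) / eps R N.
Proof.
move=> N0; have en0 := eps_neq0 R N0.
by rewrite /d2 /d3 subrK (_ : xi - 1 - 1 = xi - 2); [field|ring].
Qed.

Lemma norm_U12_subC (R : realType) (N : nat) (y z : int -> R) : (0 < N)%N ->
  norm_U12 N (y \- z) = norm_U12 N (z \- y).
Proof.
move=> N0; rewrite /norm_U12 !norm_l2E//; congr (Num.sqrt (_ * _)).
by apply: eq_bigr => i _; rewrite !d1_sub -[RHS]sqrrN opprB.
Qed.

Lemma norm_U12_triangle (R : realType) (N : nat) (x y z : int -> R) : (0 < N)%N ->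
  norm_U12 N (x \- z) <= norm_U12 N (x \- y) + norm_U12 N (y \- z).
Proof.
move=> N0; have e0 := ltW (eps_gt0 R N0).
rewrite -ler_sqr ?nnegrE ?addr_ge0 ?norm_l2_ge0//.
rewrite sqrrD /norm_U12 !sqr_norm_l2//.
set a := d1 N (x \- y); set b := d1 N (y \- z).
have := pairing_le N0 a b.
have : \sum_(1 <= i < N.+1) d1 N (x \- z) i%:Z ^+ 2 <=
    \sum_(1 <= i < N.+1) a i%:Z ^+ 2
    + 2 * \sum_(1 <= i < N.+1) `|a i%:Z| * `|b i%:Z|
    + \sum_(1 <= i < N.+1) b i%:Z ^+ 2.
  rewrite mulr_sumr -!big_split/=; apply: ler_sum => i _.
  have -> : d1 N (x \- z) i%:Z = a i%:Z + b i%:Z.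
    by rewrite /a /b !d1_sub; ring.
  by have := ler_norm (a i%:Z * b i%:Z); rewrite normrM; nra.
move=> /(ler_wpM2l e0); rewrite !mulrDr => h1 h2; apply: le_trans h1 _.
by rewrite lerD2r lerD2l mulrCA -[leRHS]mulr_natl ler_wpM2l.
Qed.

(** * Interpolation defect, stability and consistency *)

(** The first variation of [Phi_qnl] at [y] in the direction [u]. *)
Definition dPhi_qnl (R : realType) (phi : R -> R) (N : nat) (beta : int -> R)
    (y u : int -> R) : R :=
  eps R N * \sum_(1 <= i < N.+1)
    (derive1n 1 phi (d1 N y i%:Z) * d1 N u i%:Z
     + beta i%:Z * (derive1n 1 phi (d1 N y i%:Z + d1 N y (i%:Z + 1))
         * (d1 N u i%:Z + d1 N u (i%:Z + 1)))
     + (1 - beta i%:Z)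
         * (derive1n 1 phi (2 * d1 N y i%:Z) * d1 N u i%:Z
            + derive1n 1 phi (2 * d1 N y (i%:Z + 1)) * d1 N u (i%:Z + 1))).

(** The blended counterpart of [A_coef]: the coefficient of [(u')^2] in a lower
    bound for the second variation of [Phi_qnl]. *)
Definition A_qnl (R : realType) (phi : R -> R) (N : nat) (beta y : int -> R)
    (xi : int) : R :=
  derive1n 2 phi (d1 N y xi)
  + 2 * (beta xi * derive1n 2 phi (d1 N y xi + d1 N y (xi + 1))
         + (1 - beta xi) * derive1n 2 phi (2 * d1 N y xi))
  + 2 * (beta (xi - 1) * derive1n 2 phi (d1 N y (xi - 1) + d1 N y xi)
         + (1 - beta (xi - 1)) * derive1n 2 phi (2 * d1 N y xi)).

(** With [psi = phi'] this is the coefficient of [u'] in the difference of the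
    first variations of the atomistic and blended energies; with [psi = phi'']
    it is half of [A_coef - A_qnl]. *)
Definition interp_defect (R : realType) (psi : R -> R) (N : nat)
    (beta y : int -> R) (xi : int) : R :=
  (1 - beta xi) * (psi (d1 N y xi + d1 N y (xi + 1)) - psi (2 * d1 N y xi))
  + (1 - beta (xi - 1))
      * (psi (d1 N y (xi - 1) + d1 N y xi) - psi (2 * d1 N y xi)).

Section Energy.
Variables (R : realType) (phi : R -> R) (rs : R) (N : nat) (beta : int -> R).
Hypotheses (hphi : potential phi rs) (N0 : (0 < N)%N) (hbeta : blending N beta).
Local Notation e := (eps R N).
Local Notation T1 y := (fun xi => Delta beta xi * d2 N y xi).
Local Notation T2 y := (fun xi => (1 - beta (xi - 1)) * d3 N y xi).
Local Notation T3 y := (fun xi => (1 - beta xi) * d2 N y xi ^+ 2).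

(** The two bonds at a site are [2 y' + e y''_xi] and [2 y' - e y''_(xi-1)]; the
    opposite signs are what gains the second power of [e] where [beta] is
    constant. *)
Lemma interp_defect_le (k : nat) (r0 : R) (y : int -> R) (xi : int) :
  (k < 3)%N -> 0 < r0 -> (forall x, r0 <= 2 * d1 N y x) ->
  `|interp_defect (derive1n k phi) N beta y xi|
    <= e * Csup phi k.+1 r0 * `|Delta beta xi * d2 N y xi|
       + e ^+ 2 * (Csup phi k.+1 r0 * `|(1 - beta (xi - 1)) * d3 N y xi|
         + Csup phi k.+2 r0 / 2 * (`|(1 - beta xi) * d2 N y xi ^+ 2|
             + `|(1 - beta (xi - 1)) * d2 N y (xi - 1) ^+ 2|)).
Proof.
move=> k3 r00 ry; have e0 := eps_gt0 R N0; have en0 := eps_neq0 R N0.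
have /andP[b0 b1] := hbeta.2 xi; have /andP[c0 c1] := hbeta.2 (xi - 1).
have a1E : d1 N y (xi + 1) - d1 N y xi = e * d2 N y xi.
  by rewrite d2E//; field.
have a0E : d1 N y xi - d1 N y (xi - 1) = e * d2 N y (xi - 1).
  by rewrite d2E// subrK; field.
have d3_eq : d2 N y xi - d2 N y (xi - 1) = e * d3 N y xi.
  by rewrite d3E//; field.
have sp : r0 <= d1 N y xi + d1 N y (xi + 1).
  by have := ry xi; have := ry (xi + 1); lra.
have sm : r0 <= d1 N y (xi - 1) + d1 N y xi.
  by have := ry xi; have := ry (xi - 1); lra.
have tp := @taylor1_Csup R phi rs hphi k r0 _ _ k3 r00 (ry xi) sp.
have tm := @taylor1_Csup R phi rs hphi k r0 _ _ k3 r00 (ry xi) sm.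
have C1 := @le_Csup R phi rs hphi k.+1 r0 _ (leqW k3) r00 (ry xi).
rewrite /interp_defect /Delta.
move: tp tm C1.
have -> : d1 N y xi + d1 N y (xi + 1) - 2 * d1 N y xi = e * d2 N y xi.
  by rewrite -a1E; ring.
have -> : d1 N y (xi - 1) + d1 N y xi - 2 * d1 N y xi = - (e * d2 N y (xi - 1)).
  by rewrite -a0E; ring.
set p0 := derive1n k phi (2 * _); set pp := derive1n k phi (_ + d1 N y (xi + 1)).
set pm := derive1n k phi (_ + d1 N y xi); set q := derive1n k.+1 phi _.
set K1 := Csup _ k.+1 _; set K2 := Csup _ _ _.
rewrite sqrrN; set E1 := pp - p0 - _; set E2 := pm - p0 - _ => tp tm C1.
(* Summation by parts: the first-order terms combine into a difference of
   [(1 - beta) * d2 y], which the product rule splits into [Delta beta] and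
   [d3 y] contributions. *)
rewrite [X in `|X| <= _](_ : _ =
    (- (e * q * ((beta xi - beta (xi - 1)) * d2 N y xi))
     + e ^+ 2 * q * ((1 - beta (xi - 1)) * d3 N y xi))
    + ((1 - beta xi) * E1 + (1 - beta (xi - 1)) * E2)); last first.
  rewrite /E1 /E2.
  by move: d3_eq => /(congr1 ( *%R (e * q * (1 - beta (xi - 1))))) ?; lra.
have bnd (b E d : R) : 0 <= b -> `|E| <= K2 / 2 * (e * d) ^+ 2 ->
    `|b * E| <= e ^+ 2 * (K2 / 2 * `|b * d ^+ 2|).
  move=> bb hE; rewrite [in leLHS]normrM [in leRHS]normrM.
  rewrite (ger0_norm bb) (ger0_norm (sqr_ge0 d)).
  by rewrite (le_trans (ler_wpM2l bb hE))// le_eqVlt; apply/orP; left; apply/eqP; ring.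
have h1 := bnd _ _ _ (_ : 0 <= 1 - beta xi) tp.
have h2 := bnd _ _ _ (_ : 0 <= 1 - beta (xi - 1)) tm.
apply: le_trans (ler_normD _ _) _.
rewrite [X in _ <= _ + X]mulrDr [leRHS]addrA lerD//; last first.
  apply: le_trans (ler_normD _ _) _.
  by rewrite [X in _ <= _ * X]mulrDr [leRHS]mulrDr lerD ?h1 ?h2 ?subr_ge0.
apply: le_trans (ler_normD _ _) _; rewrite normrN.
rewrite lerD//; rewrite [in leLHS]normrM.
  by rewrite ler_wpM2r// normrM (gtr0_norm e0) ler_wpM2l// ltW.
rewrite mulrA ler_wpM2r// normrM ger0_norm ?sqr_ge0// ler_wpM2l ?sqr_ge0//.
Qed.

Lemma d2_periodic (y : int -> R) :
  Defs.periodic N (d1 N y) -> Defs.periodic N (d2 N y).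
Proof. by move=> py xi; rewrite !d2E// addrAC !py. Qed.

Lemma d3_periodic (y : int -> R) :
  Defs.periodic N (d1 N y) -> Defs.periodic N (d3 N y).
Proof.
by move=> /d2_periodic py xi; rewrite !d3E// [xi + N%:Z - 1]addrAC !py.
Qed.

Lemma error_terms_periodic (y : int -> R) : Defs.periodic N (d1 N y) ->
  [/\ Defs.periodic N (T1 y), Defs.periodic N (T2 y) & Defs.periodic N (T3 y)].
Proof.
have pb := hbeta.1.
move=> py; have p2 := d2_periodic py; have p3 := d3_periodic py.
by split=> xi; rewrite /Delta ?[xi + N%:Z - 1]addrAC !pb ?p2 ?p3.
Qed.

(** The first smallness condition enters here: the subtracted quantity is its
    left-hand side. *)
Lemma A_qnl_ge (r0 : R) (y : int -> R) (xi : int) :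
  0 < r0 -> Defs.periodic N (d1 N y) -> (forall x, r0 <= 2 * d1 N y x) ->
  A_coef phi N y xi - (2 * e * Csup phi 3 r0 * norm_linf N (T1 y)
      + 2 * e ^+ 2 * (Csup phi 3 r0 * norm_linf N (T2 y)
                      + Csup phi 4 r0 * norm_linf N (T3 y)))
    <= A_qnl phi N beta y xi.
Proof.
have alg (A D K3 K4 t1 t2 t3 t3' m1 m2 m3 : R) :
    D <= e * K3 * t1 + e ^+ 2 * (K3 * t2 + K4 / 2 * (t3 + t3')) ->
    e * K3 * t1 <= e * K3 * m1 -> e ^+ 2 * K3 * t2 <= e ^+ 2 * K3 * m2 ->
    e ^+ 2 * K4 * t3 <= e ^+ 2 * K4 * m3 ->
    e ^+ 2 * K4 * t3' <= e ^+ 2 * K4 * m3 ->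
    A - (2 * e * K3 * m1 + 2 * e ^+ 2 * (K3 * m2 + K4 * m3)) <= A - 2 * D.
  by lra.
move=> r00 py ry; have e0 := eps_gt0 R N0.
have [p1 p2 p3] := error_terms_periodic py.
have n1 := le_norm_linf N0 xi p1; have n2 := le_norm_linf N0 xi p2.
have n3 := le_norm_linf N0 xi p3; have n3' := le_norm_linf N0 (xi - 1) p3.
have C3 : 0 <= Csup phi 3 r0.
  by apply: le_trans (le_Csup hphi (k := 3) isT r00 (ry xi)).
have C4 : 0 <= Csup phi 4 r0.
  by apply: le_trans (le_Csup hphi (k := 4) isT r00 (ry xi)).
have -> : A_qnl phi N beta y xi =
    A_coef phi N y xi - 2 * interp_defect (derive1n 2 phi) N beta y xi.
  by rewrite /A_qnl /A_coef /interp_defect; move: (derive1n 2 phi) => f2; ring.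
have := @interp_defect_le 2 r0 y xi isT r00 ry.
move=> /(le_trans (ler_norm _))/alg; apply.
- apply: ler_wpM2l n1; exact: mulr_ge0 (ltW e0) C3.
- apply: ler_wpM2l n2; exact: mulr_ge0 (sqr_ge0 e) C3.
- apply: ler_wpM2l n3; exact: mulr_ge0 (sqr_ge0 e) C4.
- apply: ler_wpM2l n3'; exact: mulr_ge0 (sqr_ge0 e) C4.
Qed.

(** Each bond is expanded by [phi_ge_quadratic] with the curvature frozen at [y].
    Concavity of [phi] on next-nearest bonds allows
    [(v_i + v_(i+1))^2 <= 2 (v_i^2 + v_(i+1)^2)] to decouple the sites, and the
    part in [v_(i+1)] is shifted back to site [i] by periodicity. The factor 9
    adds up 1 from the bond [y'_i] and 8 from the longer ones, whose lengths
    move by up to [2 rho]. *)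
Lemma Phi_qnl_ge_quadratic (F r0 rho sigma : R) (y z w : int -> R) :
  0 < r0 -> Yspace N F y -> Yspace N F z -> Yspace N F w ->
  (forall xi, r0 + rho <= d1 N y xi) -> (forall xi, rs <= 2 * d1 N y xi) ->
  (forall xi, `|d1 N z xi - d1 N y xi| <= rho) ->
  (forall xi, `|d1 N w xi - d1 N y xi| <= rho) ->
  (forall xi, sigma + 9 * (Csup phi 3 r0 * rho) <= A_qnl phi N beta y xi) ->
  Phi_qnl phi N beta z + dPhi_qnl phi N beta z (w \- z)
    + sigma / 2 * norm_U12 N (w \- z) ^+ 2 <= Phi_qnl phi N beta w.
Proof.
move=> r00 Yy Yz Yw yr yrs zy wy hA.
have pb := hbeta.1; have b01 := hbeta.2.
have py := Yspace_d1_periodic Yy; have pz := Yspace_d1_periodic Yz.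
have pw := Yspace_d1_periodic Yw; have e0 := eps_gt0 R N0.
have rho0 : 0 <= rho by apply: le_trans (zy 0).
set L := Csup phi 3 r0.
have L0 : 0 <= L.
  apply: le_trans (le_Csup hphi (k := 3) isT r00 (_ : r0 <= d1 N y 0)) => //.
  by apply: le_trans (yr 0); rewrite lerDl.
have ge_r0 (x : int -> R) : (forall xi, `|d1 N x xi - d1 N y xi| <= rho) ->
    forall xi, r0 <= d1 N x xi.
  by move=> xy xi; have := xy xi; have := yr xi; rewrite ler_norml => ? /andP[]; lra.
have zr := ge_r0 z zy; have wr := ge_r0 w wy.
pose a := d1 N y; pose s := d1 N z; pose t := d1 N w.
pose v xi := t xi - s xi; pose f2 := derive1n 2 phi; pose f1 := derive1n 1 phi.
(* [q (xi + 1)] and [p xi] are the parts of the quadratic term of site [xi]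
   carried by [v (xi + 1)] and by [v xi]. *)
pose q xi := (beta (xi - 1) * f2 (a (xi - 1) + a xi)
              + (1 - beta (xi - 1)) * f2 (2 * a xi) - 2 * (L * rho)) * v xi ^+ 2.
pose p xi := (f2 (a xi) / 2 - L * rho / 2
   + (beta xi * f2 (a xi + a (xi + 1)) + (1 - beta xi) * f2 (2 * a xi)
      - 2 * (L * rho))) * v xi ^+ 2.
pose E (x : int -> R) xi := phi (x xi) + beta xi * phi (x xi + x (xi + 1))
  + (1 - beta xi) / 2 * (phi (2 * x xi) + phi (2 * x (xi + 1))).
pose dE xi := f1 (s xi) * v xi
  + beta xi * (f1 (s xi + s (xi + 1)) * (v xi + v (xi + 1)))
  + (1 - beta xi) * (f1 (2 * s xi) * v xi + f1 (2 * s (xi + 1)) * v (xi + 1)).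
have site xi : E s xi + dE xi + (p xi + q (xi + 1)) <= E t xi.
  have /andP[b0 b1] := b01 xi.
  have r0_2 (c : R) : r0 <= c -> r0 <= 2 * c by lra.
  have r0_D (c d : R) : r0 <= c -> r0 <= d -> r0 <= c + d by lra.
  have close2 (c d : R) : `|c - d| <= rho -> `|2 * c - 2 * d| <= 2 * rho.
    by move=> cd; rewrite -mulrBr normrM ger0_norm// ler_wpM2l.
  have closeD (c c' d d' : R) : `|c - d| <= rho -> `|c' - d'| <= rho ->
      `|c + c' - (d + d')| <= 2 * rho.
    move=> h h'; rewrite (_ : _ - _ = (c - d) + (c' - d')); last by ring.
    by apply: le_trans (ler_normD _ _) _; rewrite mulr_natl mulr2n lerD.
  have ar x : r0 <= a x by have := yr x; rewrite /a; lra.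
  have q1 := phi_ge_quadratic hphi r00 (ar xi) (zr xi) (wr xi) (zy xi) (wy xi).
  have q2 := phi_ge_quadratic hphi r00 (r0_D _ _ (ar xi) (ar (xi + 1)))
    (r0_D _ _ (zr xi) (zr (xi + 1))) (r0_D _ _ (wr xi) (wr (xi + 1)))
    (closeD _ _ _ _ (zy xi) (zy (xi + 1))) (closeD _ _ _ _ (wy xi) (wy (xi + 1))).
  have q3 x := phi_ge_quadratic hphi r00 (r0_2 _ (ar x)) (r0_2 _ (zr x))
    (r0_2 _ (wr x)) (close2 _ _ (zy x)) (close2 _ _ (wy x)).
  have concave : f2 (a xi + a (xi + 1)) <= 0.
    apply: (potential_derive2_le0 hphi).
    by have := yrs xi; have := yrs (xi + 1); rewrite /a; lra.
  move: q1 q2 (q3 xi) (q3 (xi + 1)) => {q3}.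
  rewrite /E /dE /p /q !addrK -/f1 -/f2 -/L -/(s _) -/(s _) -/(t _) -/(t _).
  rewrite -!/(a _).
  have -> : t xi = s xi + v xi by rewrite /v; ring.
  have -> : t (xi + 1) = s (xi + 1) + v (xi + 1) by rewrite /v; ring.
  set s0 := s xi; set s1 := s (xi + 1); set v0 := v xi; set v1 := v (xi + 1).
  move=> q1 q2 q3 q4; clearbody f1 f2 L a.
  have Lr : 0 <= L * rho by exact: mulr_ge0.
  have {}q2 : phi (s0 + s1) + f1 (s0 + s1) * (v0 + v1)
      + (f2 (a xi + a (xi + 1)) - 2 * (L * rho)) * (v0 ^+ 2 + v1 ^+ 2)
      <= phi (s0 + v0 + (s1 + v1)).
    apply: le_trans q2.
    have : 0 <= (2 * (L * rho) - f2 (a xi + a (xi + 1))) * (v0 - v1) ^+ 2.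
      by rewrite mulr_ge0 ?sqr_ge0//; lra.
    lra.
  have := ler_wpM2l b0 q2.
  have b1' : 0 <= (1 - beta xi) / 2 by lra.
  have := ler_wpM2l b1' (lerD q3 q4).
  lra.
have pa : Defs.periodic N a by exact: py.
have pv : Defs.periodic N v by move=> xi; rewrite /v /s /t pz pw.
have pq : Defs.periodic N q.
  by move=> xi; rewrite /q [xi + N%:Z - 1]addrAC !pb !pa !pv.
have := ler_sum (index_iota 1 N.+1) (P := predT) (fun i _ => site i%:Z).
rewrite 2!big_split/= [X in _ + X <= _]big_split/= (@sum_shift _ _ N0 q pq).
rewrite -[X in _ + X <= _]big_split/= => sumE.
have vE xi : d1 N (w \- z) xi = v xi by rewrite d1_sub.
rewrite /Phi_qnl /dPhi_qnl /norm_U12 sqr_norm_l2//.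
under [X in _ + e * X + _ <= _]eq_bigr do rewrite !vE.
under [X in _ + _ * (e * X) <= _]eq_bigr do rewrite vE.
rewrite -!mulrDr mulrCA -!mulrDr ler_wpM2l ?(ltW e0)//.
apply: le_trans sumE; rewrite lerD2l mulr_sumr; apply: ler_sum => i _.
have := ler_wpM2r (sqr_ge0 (v i%:Z)) (hA i%:Z).
rewrite /p /q /A_qnl -!/(a _) -/f2 -/L; clearbody f1 f2 L a v; lra.
Qed.

(** The constant blending function 1 yields the atomistic energy. *)
Lemma dPhi_qnl_defect (y u : int -> R) :
  Defs.periodic N (d1 N y) -> Defs.periodic N u ->
  dPhi_qnl phi N (fun=> 1) y u - dPhi_qnl phi N beta y u =
  e * \sum_(1 <= i < N.+1)
    interp_defect (derive1n 1 phi) N beta y i%:Z * d1 N u i%:Z.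
Proof.
move=> py /d1_periodic pu; have pb := hbeta.1.
rewrite /dPhi_qnl /interp_defect; move: (derive1n 1 phi) => f1.
rewrite -mulrBr -sumrB; congr (_ * _).
(* As the bond [xi] pairs with both [u'_xi] and [u'_(xi+1)], collecting the
   coefficient of one [u'] requires an index shift. *)
pose p xi := (1 - beta xi) * (f1 (d1 N y xi + d1 N y (xi + 1))
                              - f1 (2 * d1 N y xi)) * d1 N u xi.
pose q xi := (1 - beta (xi - 1)) * (f1 (d1 N y (xi - 1) + d1 N y xi)
                              - f1 (2 * d1 N y xi)) * d1 N u xi.
have pq : Defs.periodic N q.
  by move=> xi; rewrite /q [xi + N%:Z - 1]addrAC !pb !py !pu.
transitivity (\sum_(1 <= i < N.+1) (p i%:Z + q (i%:Z + 1))).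
  by apply: eq_bigr => i _; rewrite /p /q !addrK; ring.
rewrite big_split/= (sum_shift N0 pq) -big_split/=.
by apply: eq_bigr => i _; rewrite /p /q; ring.
Qed.

Lemma dPhi_qnl_consistency (r0 : R) (y u : int -> R) :
  0 < r0 -> Defs.periodic N (d1 N y) -> (forall x, r0 <= 2 * d1 N y x) ->
  Defs.periodic N u ->
  `|dPhi_qnl phi N (fun=> 1) y u - dPhi_qnl phi N beta y u|
    <= (e * Csup phi 2 r0 * norm_l2 N (T1 y)
        + e ^+ 2 * (Csup phi 2 r0 * norm_l2 N (T2 y)
                    + Csup phi 3 r0 * norm_l2 N (T3 y))) * norm_U12 N u.
Proof.
move=> r00 py ry pu; have e0 := ltW (eps_gt0 R N0).
have [p1 p2 p3] := error_terms_periodic py.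
rewrite dPhi_qnl_defect//.
have C2 : 0 <= Csup phi 2 r0.
  by apply: le_trans (le_Csup hphi (k := 2) isT r00 (ry 0)).
have C3 : 0 <= Csup phi 3 r0.
  by apply: le_trans (le_Csup hphi (k := 3) isT r00 (ry 0)).
rewrite normrM ger0_norm//.
have site i := @interp_defect_le 1 r0 y i%:Z isT r00 ry.
move: C2 C3 site; move: (Csup phi 2 r0) (Csup phi 3 r0) => K2 K3 K20 K30 site.
have c1 := pairing_le N0 (T1 y) (d1 N u).
have c2 := pairing_le N0 (T2 y) (d1 N u).
have c3 := pairing_le N0 (T3 y) (d1 N u).
have c4 := pairing_le N0 (fun xi => T3 y (xi - 1)) (d1 N u).
rewrite (norm_l2_shiftN N0 p3) in c4.
rewrite /norm_U12.
set S1 := \sum_(_ <= _ < _) _ in c1; set S2 := \sum_(_ <= _ < _) _ in c2.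
set S3 := \sum_(_ <= _ < _) _ in c3; set S4 := \sum_(_ <= _ < _) _ in c4.
apply: (@le_trans _ _ (e * (e * K2 * S1 + e ^+ 2 * (K2 * S2 + K3 / 2 * (S3 + S4))))).
  rewrite ler_wpM2l//; apply: le_trans (ler_norm_sum _ _ _) _.
  rewrite /S1 /S2 /S3 /S4 -big_split/= !mulr_sumr -big_split/= mulr_sumr -big_split/=.
  apply: ler_sum => i _; rewrite normrM.
  apply: le_trans (ler_wpM2r (normr_ge0 _) (site i)) _.
  by rewrite le_eqVlt; apply/orP; left; apply/eqP; ring.
have alg (n1 n2 n3 m s1 s2 s3 s4 : R) : s1 <= n1 * m -> s2 <= n2 * m ->
  s3 <= n3 * m -> s4 <= n3 * m ->
  e * K2 * s1 + e ^+ 2 * (K2 * s2 + K3 / 2 * (s3 + s4)) <=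
  (e * K2 * n1 + e ^+ 2 * (K2 * n2 + K3 * n3)) * m.
  move=> h1 h2 h3 h4.
  have -> : (e * K2 * n1 + e ^+ 2 * (K2 * n2 + K3 * n3)) * m =
    e * K2 * (n1 * m) + e ^+ 2 * (K2 * (n2 * m) + K3 / 2 * (n3 * m + n3 * m)).
    by field.
  have K2' : 0 <= K3 / 2 by rewrite divr_ge0.
  rewrite lerD ?ler_wpM2l ?mulr_ge0 ?sqr_ge0//.
  by rewrite lerD ?ler_wpM2l ?lerD.
apply: le_trans (alg _ _ _ _ _ _ _ _ c1 c2 c3 c4).
by rewrite le_eqVlt; apply/orP; left; apply/eqP; ring.
Qed.

End Energy.

(** * Critical points *)

Lemma is_derive_bigsum (R : realType) (I : Type) (r : seq I)
    (h : I -> R -> R) (dh : I -> R) (x : R) :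
  (forall i, is_derive x 1 (h i) (dh i)) ->
  is_derive x 1 (fun t => \sum_(i <- r) h i t) (\sum_(i <- r) dh i).
Proof.
move=> hh; elim: r => [|i r IHr].
  rewrite big_nil (_ : (fun _ => _) = cst 0); first exact: is_derive_cst.
  by apply/funext => t; rewrite big_nil.
rewrite big_cons (_ : (fun _ => _) = (h i \+ (fun t => \sum_(i <- r) h i t))).
  exact: is_deriveD.
by apply/funext => t; rewrite big_cons.
Qed.

Section Critical.
Variables (R : realType) (phi : R -> R) (rs : R) (N : nat).
Hypotheses (hphi : potential phi rs) (N0 : (0 < N)%N).
Local Notation e := (eps R N).

Lemma is_derive_phi_line (a b t : R) : 0 < a + t * b ->
  is_derive t 1 (fun t => phi (a + t * b)) (derive1n 1 phi (a + t * b) * b).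
Proof.
move=> pos; have Dphi : is_derive (a + t * b) 1 phi (derive1n 1 phi (a + t * b)).
  exact: (@potential_is_derive _ _ _ hphi 0).
apply: (@is_derive1_comp _ phi (fun t => a + t * b)).
by apply: is_derive_eq; rewrite /GRing.scale/=; ring.
Qed.

Lemma is_derive_Phi_qnl (beta y u : int -> R) (t : R) :
  (forall xi, 0 < d1 N y xi + t * d1 N u xi) ->
  is_derive t 1 (fun t => Phi_qnl phi N beta (fun x => y x + t * u x))
    (dPhi_qnl phi N beta (fun x => y x + t * u x) u).
Proof.
move=> pos; rewrite /Phi_qnl /dPhi_qnl.
apply: is_deriveZ; apply: is_derive_bigsum => i.
have line (a b : R) := @is_derive_phi_line a b t.
have pos1 := pos i%:Z; have pos2 := pos (i%:Z + 1).
rewrite !d1_add.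
pose a := d1 N y i%:Z; pose a1 := d1 N y (i%:Z + 1).
pose b := d1 N u i%:Z; pose b1 := d1 N u (i%:Z + 1).
have aE (s : R) : a + s * b + (a1 + s * b1) = a + a1 + s * (b + b1) by ring.
have a2E (c d s : R) : 2 * (c + s * d) = 2 * c + s * (2 * d) by ring.
rewrite (_ : (fun s : R => _) = (fun s => phi (a + s * b)
   + beta i%:Z * phi (a + a1 + s * (b + b1))
   + (1 - beta i%:Z) / 2
       * (phi (2 * a + s * (2 * b)) + phi (2 * a1 + s * (2 * b1))))); last first.
  by apply/funext => s; rewrite !d1_add !aE !a2E.
rewrite -!/a -!/a1 -!/b -!/b1.
rewrite -/a -/b in pos1; rewrite -/a1 -/b1 in pos2.
clearbody a a1 b b1; have D1 := line a b pos1.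
have D2 := line (a + a1) (b + b1) ltac:(by rewrite -aE addr_gt0).
have D3 := line (2 * a) (2 * b) ltac:(by rewrite -a2E mulr_gt0).
have D4 := line (2 * a1) (2 * b1) ltac:(by rewrite -a2E mulr_gt0).
apply: is_derive_eq.
by rewrite aE -!a2E /GRing.scale/=; move: (derive1n 1 phi) => f1; field.
Qed.

(** Admissibility is an open condition, so along a line through a minimizer
    Fermat's theorem applies. Arbitrary [beta] covers both the atomistic
    minimizer and the competitors of the blended one. *)
Lemma local_minimizer_critical (F : R) (beta f z u : int -> R) :
  local_minimizer N F (Phi_qnl_total phi N beta f) z -> Uspace N u ->
  dPhi_qnl phi N beta z u = pairing N f u.
Proof.
move=> [[Yz z0] [rho rho0 zmin]] Uu; have pu : Defs.periodic N u by case: Uu.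
have pz := Yspace_d1_periodic Yz.
pose mu := min_period N (d1 N z).
have mu0 : 0 < mu by apply: lt_bigmin => // i _; exact: z0.
pose K := norm_U12 N u; have K0 : 0 <= K by exact: norm_l2_ge0.
have se0 : 0 < Num.sqrt e by rewrite sqrtr_gt0 eps_gt0.
(* The first bound keeps the strains positive, the second keeps the line inside
   the neighbourhood of minimality; adding 1 allows [K = 0]. *)
pose del : R := Num.min (mu * Num.sqrt e) rho / (K + 1).
have K1 : 0 < K + 1 by lra.
have del0 : 0 < del by rewrite divr_gt0// lt_min rho0 mulr_gt0.
have delK (t : R) : `|t| < del -> `|t| * K < Num.min (mu * Num.sqrt e) rho.
  rewrite /del ltr_pdivlMr// => /le_lt_trans; apply.
  by rewrite ler_wpM2l// lerDl.
have pos (t : R) : `|t| < del -> forall xi, 0 < d1 N z xi + t * d1 N u xi.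
  move=> /delK; rewrite lt_min => /andP[tK _] xi.
  have := le_norm_l2 N0 xi (d1_periodic pu); rewrite -/(norm_U12 N u) -/K => uK.
  have := ler_wpM2l (normr_ge0 t) uK; rewrite mulrCA [in leLHS]mulrC -normrM => h.
  have := le_lt_trans h tK; rewrite ltr_pM2r// ltr_norml => /andP[+ _].
  by have := min_period_le N0 xi pz; rewrite -/mu; lra.
pose E (t : R) := Phi_qnl_total phi N beta f (fun x => z x + t * u x).
have DE (t : R) : `|t| < del -> is_derive t 1 E
    (dPhi_qnl phi N beta (fun x => z x + t * u x) u - pairing N f u).
  move=> td; have DP := is_derive_Phi_qnl beta (pos _ td).
  have -> : E = (fun t => Phi_qnl phi N beta (fun x => z x + t * u x))
                \- (fun t => pairing N f z + t * pairing N f u).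
    apply/funext => s; rewrite /E /Phi_qnl_total /=; congr (_ - _).
    rewrite /pairing mulrCA -mulrDr; congr (_ * _); rewrite mulr_sumr -big_split/=.
    by apply: eq_bigr => i _; ring.
  apply: is_deriveB; apply: is_derive_eq.
  by rewrite /GRing.scale/=; ring.
have E0 : E 0 = Phi_qnl_total phi N beta f z.
  rewrite /E; congr (Phi_qnl_total _ _ _ _ _).
  by apply/funext => x; rewrite mul0r addr0.
have itvE (t : R) : (t \in `]- del, del[) = (`|t| < del).
  by rewrite in_itv/= ltr_norml.
have D0 : is_derive (0 : R) 1 E 0.
  apply: (@derive1_at_min R E (- del) del 0).
  - by rewrite lerNl; lra.
  - by move=> t; rewrite itvE => /DE Dt; exact: ex_derive.
  - by rewrite itvE normr0.
  - move=> t; rewrite itvE => td; rewrite E0; apply: zmin.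
      split; first exact: Yspace_add.
      by move=> xi; rewrite d1_add; exact: pos.
    rewrite (_ : (_ \- _) = fun x => t * u x); last by apply/funext => x /=; ring.
    rewrite /norm_U12 (_ : d1 N _ = fun x => t * d1 N u x).
      rewrite norm_l2Z//; have := delK _ td; rewrite lt_min => /andP[_].
      by [].
    by apply/funext => x; rewrite /d1; ring.
have zE : (fun x => z x + 0 * u x) = z.
  by apply/funext => x; rewrite mul0r addr0.
have := DE 0; rewrite normr0 zE => /(_ del0) D0'; apply/eqP; rewrite -subr_eq0.
by rewrite -(@derive_val _ _ _ _ _ _ _ D0') (@derive_val _ _ _ _ _ _ _ D0).
Qed.

End Critical.

(** * Compactness and existence of a minimizer on a ball *)

(** Row vectors as coordinates for [N]-periodic lattice functions: they carry the
    topology in which closed balls are compact. *)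
Definition pext (R : realType) (n : nat) (w : 'rV[R]_n.+1) (xi : int) : R :=
  w ord0 (inord `|(xi %% n.+1%:Z)%Z|).

Lemma pext_periodic (R : realType) (n : nat) (w : 'rV[R]_n.+1) :
  Defs.periodic n.+1 (pext w).
Proof. by move=> xi; rewrite /pext modzDr. Qed.

Lemma pext_row (R : realType) (n : nat) (u : int -> R) :
  Defs.periodic n.+1 u -> pext (\row_(j < n.+1) u j%:Z) = u.
Proof.
move=> pu; apply/funext => xi; rewrite /pext mxE inordK.
  rewrite gez0_abs ?modz_ge0// {2}(divz_eq xi n.+1%:Z) addrC.
  by rewrite periodic_mulz.
by rewrite -ltz_nat gez0_abs ?modz_ge0// ltz_pmod.
Qed.

Lemma pext_ord (R : realType) (n : nat) (w : 'rV[R]_n.+1) (j : 'I_n.+1) :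
  pext w j%:Z = w ord0 j.
Proof.
rewrite /pext modz_small; last by rewrite lez_nat ltz_nat ltn_ord.
by rewrite absz_nat inord_val.
Qed.

Section Compactness.
Variables (R : realType) (n : nat).
Local Notation N := n.+1.
Local Notation e := (eps R N).

Lemma continuous_for_cst (T : topologicalType) (c : R) (x : T) :
  {for x, continuous (fun=> c)}.
Proof. exact: (@cst_continuous T R c x). Qed.

Lemma continuous_forD (T : topologicalType) (g h : T -> R) (x : T) :
  {for x, continuous g} -> {for x, continuous h} ->
  {for x, continuous (fun w => g w + h w)}.
Proof. by move=> cg ch; exact: (@continuousD _ _ _ g h x cg ch). Qed.

Lemma continuous_forB (T : topologicalType) (g h : T -> R) (x : T) :
  {for x, continuous g} -> {for x, continuous h} ->
  {for x, continuous (fun w => g w - h w)}.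
Proof. by move=> cg ch; exact: (@continuousB _ _ _ g h x cg ch). Qed.

Lemma continuous_forMl (T : topologicalType) (c : R) (h : T -> R) (x : T) :
  {for x, continuous h} -> {for x, continuous (fun w => c * h w)}.
Proof. by move=> ch; exact: (@continuousM _ _ (cst c) h x (cvg_cst _) ch). Qed.

Lemma continuous_for_sum (T : topologicalType) (h : nat -> T -> R) (x : T) :
  (forall i, {for x, continuous (h i)}) ->
  {for x, continuous (fun w => \sum_(1 <= i < N.+1) h i w)}.
Proof. by move=> ch; apply: cvg_big => [|i _]; [exact: add_continuous|exact: ch]. Qed.

Lemma continuous_pext (xi : int) : continuous (fun w : 'rV[R]_N => pext w xi).
Proof. by move=> w; exact: coord_continuous. Qed.

Lemma continuous_d1_pext (xi : int) :
  continuous (fun w : 'rV[R]_N => d1 N (pext w) xi).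
Proof.
move=> w.
exact: (cvgMr_tmp (cvgB (@continuous_pext xi w) (@continuous_pext (xi - 1) w))).
Qed.

(** The energy norm only sees strains; boundedness in [u] itself comes from the
    zero mean through [Uspace_bound]. *)
Lemma closed_ball_U_compact (d : R) :
  compact [set w : 'rV[R]_N | Uspace N (pext w) /\ norm_U12 N (pext w) <= d]%classic.
Proof.
pose B := (e * (d / Num.sqrt e)) *+ N.
have box : compact [set w : 'rV[R]_N | forall j, w ord0 j \in `[- B, B]].
  apply: (@rV_compact R N (fun=> `[(- B), B]%classic)).
  by move=> _; apply: segment_compact.
have se0 : 0 < Num.sqrt e by rewrite sqrtr_gt0 eps_gt0.
apply: (subclosed_compact _ box); last first.
  move=> w [Uw wd] j; rewrite in_itv/= -ler_norml -pext_ord.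
  apply: Uspace_bound Uw _ _ => // xi.
  have := le_norm_l2 (ltn0Sn n) xi (d1_periodic (pext_periodic w)).
  move=> /le_trans/(_ wd); rewrite mulrC -ler_pdivlMr// => h.
  rewrite (_ : pext w xi - _ = e * d1 N (pext w) xi); last first.
    by rewrite /d1 mulrCA divff ?mulr1// eps_neq0.
  by rewrite normrM gtr0_norm ?eps_gt0// ler_wpM2l// ltW// eps_gt0.
pose g (w : 'rV[R]_N) := \sum_(1 <= i < N.+1) pext w i%:Z.
pose h (w : 'rV[R]_N) := norm_U12 N (pext w).
rewrite (_ : [set w | _]%classic =
  (g @^-1` [set x | x = 0] `&` h @^-1` [set x | x <= d])%classic); last first.
  apply/seteqP; split => w /=; first by move=> [[]].
  by move=> [gw hw]; split => //; split => //; exact: pext_periodic.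
apply: closedI; apply: preimage_closed.
- by move=> w _; apply: continuous_for_sum => i; exact: continuous_pext.
- exact: closed_eq.
- move=> w _; rewrite /h /norm_U12.
  under eq_fun do rewrite norm_l2E//.
  apply: (@continuous_comp _ _ _
    (fun w => e * \sum_(1 <= i < N.+1) d1 N (pext w) i%:Z ^+ 2) Num.sqrt); last first.
    exact: sqrt_continuous.
  apply: continuous_forMl; apply: continuous_for_sum => i.
  apply: (@continuous_comp _ _ _ (fun w => d1 N (pext w) i%:Z) (fun x => x ^+ 2)).
    exact: continuous_d1_pext.
  exact: exprn_continuous.
- exact: closed_le.
Qed.

End Compactness.

(** Positive strains on the ball are needed for continuity, as [phi] is only
    regular on the positive half-line. *)
Lemma Phi_qnl_min_on_ball (R : realType) (phi : R -> R) (rs : R) (N : nat)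
    (F d : R) (beta f y : int -> R) :
  potential phi rs -> (0 < N)%N -> 0 <= d -> Yspace N F y ->
  (forall z, Yspace N F z -> norm_U12 N (z \- y) <= d ->
    forall xi, 0 < d1 N z xi) ->
  exists yb, [/\ Yspace N F yb, norm_U12 N (yb \- y) <= d &
    forall z, Yspace N F z -> norm_U12 N (z \- y) <= d ->
      Phi_qnl_total phi N beta f yb <= Phi_qnl_total phi N beta f z].
Proof.
move=> hphi; case: N => // n _ d0 Yy pos.
pose K := [set w : 'rV[R]_n.+1 |
  Uspace n.+1 (pext w) /\ norm_U12 n.+1 (pext w) <= d]%classic.
pose Y (w : 'rV[R]_n.+1) xi := y xi + 1 * pext w xi.
have subY w : Y w \- y = pext w by apply/funext => xi; rewrite /Y /=; ring.
have YK w : K w -> Yspace n.+1 F (Y w) /\ norm_U12 n.+1 (Y w \- y) <= d.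
  by move=> [Uw wd]; split; [exact: Yspace_add | rewrite subY].
have K0 : (K !=set0)%classic.
  exists 0; rewrite /K/=; have -> : pext (0 : 'rV[R]_n.+1) = fun=> 0.
    by apply/funext => xi; rewrite /pext mxE.
  split; first by split => //; rewrite big1.
  rewrite /norm_U12 norm_l2E// big1 ?mulr0 ?sqrtr0// => i _.
  by rewrite /d1 subrr mul0r expr0n.
have cont : {within K,
    continuous (fun w => Phi_qnl_total phi n.+1 beta f (Y w))}%classic.
  apply: continuous_in_subspaceT => w; rewrite inE => /YK[YYw wd].
  have posw := pos _ YYw wd.
  have phi_cont (h : 'rV[R]_n.+1 -> R) : {for w, continuous h} -> 0 < h w ->
      {for w, continuous (fun w => phi (h w))}.
    move=> ch hw; apply: (@continuous_comp _ _ _ h phi) => //.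
    exact: (@potential_continuous_at _ _ _ hphi 0).
  have cd xi : {for w, continuous (fun w => d1 n.+1 (Y w) xi)}.
    have -> : (fun w => d1 n.+1 (Y w) xi) =
        (fun w => d1 n.+1 y xi + 1 * d1 n.+1 (pext w) xi).
      by apply/funext => w'; rewrite /Y d1_add.
    apply: continuous_forD; first exact: continuous_for_cst.
    by apply: continuous_forMl; exact: continuous_d1_pext.
  have cPhi : {for w, continuous (fun w => Phi_qnl phi n.+1 beta (Y w))}.
    apply: continuous_forMl; apply: continuous_for_sum => i.
    have p1 := posw i%:Z; have p2 := posw (i%:Z + 1).
    apply: continuous_forD; first apply: continuous_forD.
    - exact: phi_cont.
    - apply: continuous_forMl; apply: phi_cont; last exact: addr_gt0.
      by apply: continuous_forD; exact: cd.
    apply: continuous_forMl; apply: continuous_forD.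
      by apply: phi_cont; [apply: continuous_forMl; exact: cd|rewrite mulr_gt0].
    by apply: phi_cont; [apply: continuous_forMl; exact: cd|rewrite mulr_gt0].
  have cf : {for w, continuous (fun w => pairing n.+1 f (Y w))}.
    apply: continuous_forMl; apply: continuous_for_sum => i; apply: continuous_forMl.
    apply: continuous_forD; first exact: continuous_for_cst.
    by apply: continuous_forMl; exact: continuous_pext.
  exact: (continuous_forB cPhi cf).
have [w] := compact_EVT_min K0 (@closed_ball_U_compact R n d) cont.
rewrite inE => /YK[Yw wd] wmin; exists (Y w); split => // z Yz zd.
have Uz := Yspace_sub Yz Yy; have pz : Defs.periodic n.+1 (z \- y) by case: Uz.
have rowE := @pext_row R n (z \- y) pz; set v := \row__ _ in rowE.
have Kv : K v by rewrite /K /mkset rowE; split.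
have := wmin v (mem_set Kv); rewrite (_ : Y v = z)//.
by apply/funext => xi; rewrite /Y rowE /=; ring.
Qed.

(** * A locally unique minimizer near a stable, nearly critical configuration *)

Lemma Phi_a_qnl (R : realType) (phi : R -> R) (N : nat) (f : int -> R) :
  Phi_a_total phi N f = Phi_qnl_total phi N (fun=> 1) f.
Proof.
apply/funext => y; congr (_ * _ - _).
by apply: eq_bigr => i _; rewrite subrr !mul0r addr0 mul1r.
Qed.

(** The minimizer [yb] over the closed ball of radius [d] satisfies
    [sigma / 2 |yb - y|^2 <= eta |yb - y|] by the convexity inequality from [y],
    so it is interior. The same inequality started from a competing local
    minimizer, where the first variation vanishes, leaves no room for a second
    one. *)
Lemma qnl_minimizer_near (R : realType) (phi : R -> R) (rs : R) (N : nat)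
    (beta f y : int -> R) (F r0 rho sigma eta : R) :
  potential phi rs -> (0 < N)%N -> blending N beta -> Yspace N F y ->
  0 < r0 -> 0 < sigma ->
  (forall xi, r0 + rho <= d1 N y xi) -> (forall xi, rs <= 2 * d1 N y xi) ->
  (forall xi, sigma + 9 * (Csup phi 3 r0 * rho) <= A_qnl phi N beta y xi) ->
  (forall u, Uspace N u ->
    `|dPhi_qnl phi N beta y u - pairing N f u| <= eta * norm_U12 N u) ->
  0 <= eta -> 2 * eta / sigma < rho * Num.sqrt (eps R N) ->
  exists2 yb, locally_unique_minimizer N F (Phi_qnl_total phi N beta f) yb &
    norm_U12 N (y \- yb) <= 2 * eta / sigma.
Proof.
move=> hphi N0 hbeta Yy r00 sigma0 yr yrs hA hres eta0 small.
have se0 : 0 < Num.sqrt (eps R N) by rewrite sqrtr_gt0 eps_gt0.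
pose E := Phi_qnl_total phi N beta f; pose d := rho * Num.sqrt (eps R N).
have etas0 : 0 <= 2 * eta / sigma by rewrite divr_ge0 ?mulr_ge0// ltW.
have d0 : 0 < d by exact: le_lt_trans small.
have close z : Yspace N F z -> norm_U12 N (z \- y) <= d ->
    forall xi, `|d1 N z xi - d1 N y xi| <= rho.
  move=> Yz zd xi; have [pzy _] := Yspace_sub Yz Yy.
  have := le_trans (le_norm_l2 N0 xi (d1_periodic pzy)) zd.
  by rewrite d1_sub /d mulrC ler_pM2r.
have pos z : Yspace N F z -> norm_U12 N (z \- y) <= d -> forall xi, 0 < d1 N z xi.
  move=> Yz zd xi; have := close _ Yz zd xi; have := yr xi.
  by rewrite ler_norml => ? /andP[? _]; lra.
have yd : norm_U12 N (y \- y) <= d.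
  rewrite /norm_U12 norm_l2E// big1 ?mulr0 ?sqrtr0 ?ltW// => i _.
  by rewrite d1_sub subrr expr0n.
have convex z w : Yspace N F z -> norm_U12 N (z \- y) <= d ->
    Yspace N F w -> norm_U12 N (w \- y) <= d ->
    E z + (dPhi_qnl phi N beta z (w \- z) - pairing N f (w \- z))
      + sigma / 2 * norm_U12 N (w \- z) ^+ 2 <= E w.
  move=> Yz zd Yw wd.
  have := Phi_qnl_ge_quadratic hphi N0 hbeta r00 Yy Yz Yw yr yrs
    (close _ Yz zd) (close _ Yw wd) hA.
  have -> : pairing N f (w \- z) = pairing N f w - pairing N f z.
    rewrite /pairing -mulrBr -sumrB; congr (_ * _).
    by apply: eq_bigr => i _ /=; ring.
  by rewrite /E /Phi_qnl_total; lra.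
have [yb [Yyb ybd ybmin]] := Phi_qnl_min_on_ball beta f hphi N0 (ltW d0) Yy pos.
set t := norm_U12 N (yb \- y) in ybd.
have t0 : 0 <= t by exact: norm_l2_ge0.
have tle : t <= 2 * eta / sigma.
  have h1 := convex _ _ Yy yd Yyb ybd; have h2 := ybmin _ Yy yd.
  have h3 := hres _ (Yspace_sub Yyb Yy).
  move: h1 h2 h3; rewrite -/t -/E ler_norml => h1 h2 /andP[h3 _].
  rewrite ler_pdivlMr//.
  have : t * (t * sigma) <= t * (2 * eta) by rewrite -/t in h1 h3 *; lra.
  have [t00 _|tn0] := eqVneq t 0; first by rewrite t00 mul0r mulr_ge0.
  by rewrite ler_pM2l// lt0r tn0.
have gap : 0 < d - t by rewrite subr_gt0; exact: le_lt_trans small.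
have inball z : norm_U12 N (z \- yb) < d - t -> norm_U12 N (z \- y) <= d.
  by have := norm_U12_triangle z yb y N0; rewrite -/t; lra.
exists yb; last by rewrite norm_U12_subC.
split.
  split; first by split => //; exact: pos.
  by exists (d - t) => // z [Yz _] /inball zd; exact: ybmin.
exists (d - t) => // z zmin /inball zd; have [[Yz _] _] := zmin.
have Uybz := Yspace_sub Yyb Yz.
have := convex _ _ Yz zd Yyb ybd.
rewrite (local_minimizer_critical hphi N0 zmin Uybz) subrr addr0 => h.
have n0 : norm_U12 N (yb \- z) = 0.
  apply/eqP; rewrite -sqrf_eq0 eq_le sqr_ge0 andbT.
  rewrite -(pmulr_rle0 _ (divr_gt0 sigma0 (ltr0n _ 2))).
  by have := ybmin _ Yz zd; rewrite -/E; lra.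
apply/funext => xi; apply/esym/eqP; rewrite -subr_eq0; apply/eqP.
exact: (Uspace_norm_eq0 N0 Uybz n0 xi).
Qed.

Theorem theorem5p2 (R : realType) (phi : R -> R) (rs : R)
    (hphi : potential phi rs) :
  exists (delta1 : R -> R) (delta2 : R -> R -> R -> R -> (int -> R) -> R),
    (forall a : R, 0 < a -> 0 < delta1 a) /\
    (forall (m a c2 c3 : R) (b : int -> R),
       0 < m -> 0 < a -> 0 < delta2 m a c2 c3 b) /\
    forall (N : nat) (F : R) (f y beta : int -> R),
      (0 < N)%N -> 0 < F -> Uspace N f ->
      local_minimizer N F (Phi_a_total phi N f) y ->
      let e : R := eps R N in
      let A : R := min_period N (A_coef phi N y) in
      let m : R := min_period N (d1 N y) in
      let C2 : R := Csup phi 2 (2 * m) in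
      let C3 : R := Csup phi 3 (2 * m) in
      let C4 : R := Csup phi 4 (2 * m) in
      let T1 : int -> R := fun xi => Delta beta xi * d2 N y xi in
      let T2 : int -> R := fun xi => (1 - beta (xi - 1)) * d3 N y xi in
      let T3 : int -> R := fun xi => (1 - beta xi) * d2 N y xi ^+ 2 in
      0 < A -> rs / 2 <= m -> blending N beta ->
      2 * e * C3 * norm_linf N T1
        + 2 * e ^+ 2 * (C3 * norm_linf N T2 + C4 * norm_linf N T3)
        <= delta1 A ->
      e `^ (1 / 2) * C2 * norm_l2 N T1
        + e `^ (3 / 2) * (C2 * norm_l2 N T2 + C3 * norm_l2 N T3)
        <= delta2 m A C2 C3 beta ->
      exists2 yb : int -> R,
        locally_unique_minimizer N F (Phi_qnl_total phi N beta f) yb &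
        norm_U12 N (y \- yb)
          <= 4 / A * (e * C2 * norm_l2 N T1
               + e ^+ 2 * (C2 * norm_l2 N T2 + C3 * norm_l2 N T3)).
Proof.
(* [rho <= m / 2] keeps all strains above [m / 2], where [L m] bounds the third
   derivative; [rho <= A / (36 L)] makes the loss of convexity [9 L rho] at most
   [A / 4]. With [delta1 = A / 4] the modulus [A / 2] is left. The value of
   [delta2] keeps the error bound [4 eta / A] below half the radius
   [rho sqrt e]. *)
pose L m := `|Csup phi 3 (m / 2)| + 1.
pose rho (m a : R) := Num.min (m / 2) (a / (36 * L m)).
have L0 m : 0 < L m by rewrite ltr_wpDl.
have rho0 m a : 0 < m -> 0 < a -> 0 < rho m a.
  by move=> m0 a0; rewrite lt_min !divr_gt0 ?mulr_gt0.
exists (fun a => a / 4), (fun m a _ _ _ => a * rho m a / 8); split.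
  by move=> a a0; rewrite divr_gt0.
split; first by move=> m a _ _ _ m0 a0; rewrite divr_gt0 ?mulr_gt0 ?rho0.
move=> N F f y beta N0 _ _ ymin e A m C2 C3 C4 T1 T2 T3 A0 rsm hbeta stab cons.
have [[Yy _] _] := ymin; have py := Yspace_d1_periodic Yy.
have m0 : 0 < m.
  by apply: lt_le_trans rsm; rewrite divr_gt0// (potential_rs_gt0 hphi).
have my xi : m <= d1 N y xi by exact: min_period_le.
have pA : Defs.periodic N (A_coef phi N y).
  by move=> xi; rewrite /A_coef [xi + N%:Z + 1]addrAC [xi + N%:Z - 1]addrAC !py.
have Ay xi : A <= A_coef phi N y xi by exact: min_period_le.
have m2y x : 2 * m <= 2 * d1 N y x by rewrite ler_wpM2l.
have m20 : 0 < 2 * m by rewrite mulr_gt0.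
pose eta := e * C2 * norm_l2 N T1
  + e ^+ 2 * (C2 * norm_l2 N T2 + C3 * norm_l2 N T3).
have e0 : 0 < e by exact: eps_gt0.
have nonneg (K2 K3 s1 s2 s3 : R) : 0 <= K2 -> 0 <= K3 -> 0 <= s1 -> 0 <= s2 ->
    0 <= s3 -> 0 <= e * K2 * s1 + e ^+ 2 * (K2 * s2 + K3 * s3).
  by move=> *; rewrite !(addr_ge0, mulr_ge0, sqr_ge0)// ltW.
(* The second smallness condition bounds [eta / sqrt e]. *)
have factor (K2 K3 s1 s2 s3 : R) :
    e * K2 * s1 + e ^+ 2 * (K2 * s2 + K3 * s3)
    = Num.sqrt e * (e `^ (1 / 2) * K2 * s1 + e `^ (3 / 2) * (K2 * s2 + K3 * s3)).
  have -> : e `^ (1 / 2) = Num.sqrt e by rewrite div1r powR12_sqrt// ltW.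
  have -> : e `^ (3 / 2) = e * Num.sqrt e.
    rewrite (_ : 3 / 2 = 1 + 2^-1 :> R); last by field.
    by rewrite powRD ?gt_eqF ?implybT// powRr1 ?powR12_sqrt// ltW.
  rewrite -[in LHS](sqr_sqrtr (ltW e0)).
  by rewrite -[X in X * Num.sqrt e](sqr_sqrtr (ltW e0)); ring.
have C20 : 0 <= C2 by apply: le_trans (le_Csup hphi (k := 2) isT m20 (m2y 0)).
have C30 : 0 <= C3 by apply: le_trans (le_Csup hphi (k := 3) isT m20 (m2y 0)).
have eta0 : 0 <= eta.
  by apply: nonneg; rewrite ?norm_l2_ge0.
have etaE : eta <= Num.sqrt e * (A * rho m A / 8).
  by rewrite /eta factor; exact: ler_wpM2l (sqrtr_ge0 e) _ _ cons.
have small : 2 * eta / (A / 2) < rho m A * Num.sqrt e.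
  have s0 : 0 < Num.sqrt e by rewrite sqrtr_gt0.
  rewrite ltr_pdivrMr ?divr_gt0//; apply: le_lt_trans (ler_wpM2l _ etaE) _ => //.
  have : 0 < Num.sqrt e * (A * rho m A) by rewrite !mulr_gt0 ?rho0.
  by lra.
have rhoL : 9 * (Csup phi 3 (m / 2) * rho m A) <= A / 4.
  have h1 : rho m A <= A / (36 * L m) by rewrite ge_min lexx orbT.
  have h2 : Csup phi 3 (m / 2) <= L m by rewrite ler_wpDr// ler_norm.
  have h3 := ler_wpM2r (ltW (rho0 _ _ m0 A0)) h2.
  have h4 := ler_wpM2l (ltW (L0 m)) h1.
  have h5 : L m * (A / (36 * L m)) = A / 36 by field; rewrite gt_eqF.
  rewrite h5 in h4; have := le_trans h3 h4.
  by move: (Csup _ _ _) => K; lra.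
have [||||||yb ybmin ybd] := @qnl_minimizer_near R phi rs N beta f y F (m / 2)
  (rho m A) (A / 2) eta hphi N0 hbeta Yy _ _ _ _ _ _ eta0 small.
- by rewrite divr_gt0.
- by rewrite divr_gt0.
- move=> xi; apply: le_trans (my xi).
  have : rho m A <= m / 2 by rewrite ge_min lexx.
  by lra.
- by move=> xi; have := my xi; move: rsm; lra.
- move=> xi; apply: le_trans (A_qnl_ge hphi N0 hbeta xi m20 py m2y).
  have := Ay xi; move: stab rhoL; rewrite -/e -/C3 -/C4 -/T1 -/T2 -/T3.
  by move: (_ + 2 * e ^+ 2 * _) (9 * _) (A_coef _ _ _ _) => S1 S2 S3; lra.
- move=> u Uu; rewrite Phi_a_qnl in ymin.
  rewrite -(local_minimizer_critical hphi N0 ymin Uu) distrC.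
  case: (Uu) => pu _; exact (dPhi_qnl_consistency hphi N0 hbeta m20 py m2y pu).
exists yb => //; apply: le_trans ybd _; rewrite -/eta.
by rewrite (_ : 2 * eta / (A / 2) = 4 / A * eta)//; field; rewrite gt_eqF.
Qed.
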